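(* Let $p$ and $q$ be prime numbers with $p<q$ and $p \equiv q \equiv 3 \pmod 4$. Then $$\kappa^+(pq) \equiv 1 - \left(\frac{q}{p}\right) \pmod 4,$$ where $\left(\frac{q}{p}\right)$ is the Legendre symbol.
   Context: A real quadratic number is a real irrational root $w$ of a quadratic polynomial with integer coefficients; $w'$ denotes its algebraic conjugate over $\mathbb{Q}$. The discriminant $\mathrm{disc}(w)$ of $w$ is $b^2-4ac$, where $aw^2+bw+c=0$ with $a,b,c\in\mathbb{Z}$, $a>0$, $\gcd(a,b,c)=1$. A real quadratic number $w$ is m-reduced if $w>1$ and $0<w'<1$. For a positive non-square integer $D$, $\kappa^+(D)$ denotes the (finite) number of m-reduced real quadratic numbers $w$ with $\mathrm{disc}(w)=D$. *)

(* Defs.v *)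
From mathcomp Require Import all_boot all_order all_algebra.
From mathcomp Require Import finmap.
From mathcomp Require Import all_classical all_reals.

Set Implicit Arguments.
Unset Strict Implicit.
Unset Printing Implicit Defensive.

Import Order.TTheory GRing.Theory Num.Theory.

Local Open Scope classical_set_scope.
Local Open Scope ring_scope.

Definition real_quadratic (R : realType) (w : R) : Prop :=
  irrational w /\
  exists p : {poly int}, size p = 3%N /\ root (map_poly intr p) w.

(* The conjugate of a real quadratic number: the other real number that is a
   root of exactly the same polynomials over the rationals. *)
Definition is_conjugate (R : realType) (w w' : R) : Prop :=
  w' != w /\
  forall p : {poly rat}, root (map_poly ratr p) w = root (map_poly ratr p) w'.

(* For irrational w the triple (a, b, c), hence d, is determined by w. *)
Definition has_disc (R : realType) (w : R) (d : int) : Prop :=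
  exists a b c : int,
    [/\ 0 < a, gcdz a (gcdz b c) = 1,
        a%:~R * w ^+ 2 + b%:~R * w + c%:~R = 0
      & d = b ^+ 2 - 4 * a * c].

Definition m_reduced (R : realType) (w : R) : Prop :=
  [/\ real_quadratic w, 1 < w
    & exists2 w' : R, is_conjugate w w' & 0 < w' < 1].

(* [fset_set] returns the empty set on infinite sets; the set counted here is
   finite, since an m-reduced root of a x^2 + b x + c with a > 0 satisfies
   c > 0, a + b + c < 0 and D = (a - c)^2 + (- b - a - c) (- b + a + c). *)
Definition kappa_plus (R : realType) (D : nat) : nat :=
  #|` fset_set [set w : R | m_reduced w /\ has_disc w D%:Z]|.

Definition legendre (a : int) (p : nat) : int :=
  if (p%:Z %| a)%Z then 0
  else if [exists x : 'I_p, (x%:Z ^+ 2 == a %[mod p%:Z])%Z] then 1 else -1.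

(* Main.v *)
Require Import Defs.
From mathcomp Require Import all_boot all_order all_algebra all_field.
From mathcomp Require Import finmap all_classical all_reals.
From mathcomp Require Import zify ring lra.

(** A number w > 1 > w' > 0 of discriminant D is the larger root of
    a X^2 - (a + c + m) X + c with a, c, m > 0, so kappa^+(D) counts the positive
    triples (a, c, m) with x^2 + 4 m c = D, where x = m + a - c.  As in Zagier's
    one-sentence proof of the two-squares theorem, two involutions act on these
    triples: the swap of a and c, which fixes exactly one triple with m = 1 and one
    with m = p, and a "flip" that has no fixed point because D is not a square.
    A sign that combines a genus character modulo p with a 2-adic character is
    invariant under the swap and reversed by the flip.  So half of the triples have
    positive sign, and their number has the parity of the number of swap-fixed triples of
    positive sign; the triple with m = 1 is always positive, the one with m = p is
    positive exactly when q is a square modulo p. *)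

Set Implicit Arguments.
Unset Strict Implicit.
Unset Printing Implicit Defensive.

Import Order.TTheory GRing.Theory Num.Theory.

Local Open Scope ring_scope.

(** * Quadratic residues modulo a prime congruent to 3 modulo 4 *)

Lemma Euclid_dvdzM (p : nat) (y z : int) :
  prime p -> (p %| y * z)%Z = (p %| y)%Z || (p %| z)%Z.
Proof. by move=> hp; rewrite !dvdzE abszM Euclid_dvdM. Qed.

Lemma Euclid_dvdz_sqr (p : nat) (y : int) : prime p -> (p %| y ^+ 2)%Z = (p %| y)%Z.
Proof. by move=> hp; rewrite expr2 Euclid_dvdzM// orbb. Qed.

Lemma Fp_oner_neqN1 (p : nat) : prime p -> (p = 3 %[mod 4])%N -> (1 : 'F_p) != -1.
Proof.
move=> hp hp3; rewrite -subr_eq0 opprK -[1 + 1]/(2%:R).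
by rewrite -(dvdn_pcharf (pchar_Fp hp)) gtnNdvd//; lia.
Qed.

(** Euler's criterion serves as the definition, so that multiplicativity is that of powers; a
    multiple of an odd prime [p] gives [false]. *)
Definition euler_residue (p : nat) (y : int) : bool :=
  (y%:~R : 'F_p) ^+ p.-1./2 == 1.

Lemma Fp_half_expf_sq (p : nat) (y : 'F_p) : prime p -> (p = 3 %[mod 4])%N ->
  y != 0 -> (y ^+ p.-1./2) ^+ 2 = 1.
Proof.
move=> hp hp3 y0; rewrite -exprM.
have -> : (p.-1./2 * 2 = p.-1)%N by lia.
apply: (mulfI y0); rewrite -exprS mulr1 prednK ?prime_gt0//.
by have := expf_card y; rewrite card_Fp.
Qed.

(** The exponent [p.-1./2] is odd, so -1 is a non-residue. *)
Lemma euler_residueN (p : nat) (y : int) : prime p -> (p = 3 %[mod 4])%N ->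
  ~~ (p %| y)%Z -> euler_residue p (- y) = ~~ euler_residue p y.
Proof.
move=> hp hp3; rewrite (dvdz_pcharf (pchar_Fp hp)) => y0.
rewrite /euler_residue rmorphN /= exprNn.
have -> : (-1 : 'F_p) ^+ p.-1./2 = -1.
  have -> : (p.-1./2 = (p %/ 4).*2.+1)%N by lia.
  by rewrite -signr_odd /= odd_double.
have n1 := Fp_oner_neqN1 hp hp3.
have /eqP := Fp_half_expf_sq hp hp3 y0.
rewrite sqrf_eq1 => /orP[] /eqP ->; rewrite mulN1r ?opprK eqxx ?[RHS]/=.
  by rewrite eq_sym (negbTE n1).
by rewrite eq_sym n1.
Qed.

Lemma eq_euler_residue (p : nat) (y z : int) : prime p -> (p %| y - z)%Z ->
  euler_residue p y = euler_residue p z.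
Proof.
move=> hp; rewrite (dvdz_pcharf (pchar_Fp hp)) rmorphB /= subr_eq0 => /eqP e.
by rewrite /euler_residue e.
Qed.

Lemma euler_residueM (p : nat) (y z : int) : prime p -> (p = 3 %[mod 4])%N ->
  ~~ (p %| y)%Z -> ~~ (p %| z)%Z ->
  euler_residue p (y * z) = (euler_residue p y == euler_residue p z).
Proof.
move=> hp hp3; rewrite !(dvdz_pcharf (pchar_Fp hp)) => y0 z0.
rewrite /euler_residue rmorphM /= exprMn.
have n1 := Fp_oner_neqN1 hp hp3.
have /eqP := Fp_half_expf_sq hp hp3 y0.
have /eqP := Fp_half_expf_sq hp hp3 z0.
rewrite !sqrf_eq1 => /orP[] /eqP -> /orP[] /eqP ->.
all: by rewrite ?mulN1r ?mul1r ?mulr1 ?opprK ?eqxx ?[-1 == 1]eq_sym ?(negbTE n1).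
Qed.

Lemma euler_residue_sqr (p : nat) (y : int) : prime p -> (p = 3 %[mod 4])%N ->
  ~~ (p %| y)%Z -> euler_residue p (y ^+ 2).
Proof. by move=> hp hp3 y0; rewrite expr2 euler_residueM// eqxx. Qed.

Lemma legendre_euler (p : nat) (y : int) : prime p -> (p = 3 %[mod 4])%N ->
  ~~ (p %| y)%Z -> legendre y p = if euler_residue p y then 1 else -1.
Proof.
move=> hp hp3 y0; rewrite /legendre (negbTE y0).
suff -> : [exists x : 'I_p, (x%:Z ^+ 2 == y %[mod p])%Z] = euler_residue p y.
  by [].
apply/existsP/idP => [[x]|e].
  rewrite eqz_mod_dvd => xy.
  rewrite -(eq_euler_residue hp xy) euler_residue_sqr//.
  apply: contra y0 => px.
  have : (p %| x%:Z ^+ 2 - (x%:Z ^+ 2 - y))%Z.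
    by apply: rpredB; rewrite // dvdz_exp.
  by rewrite opprB addrC subrK.
have p0 := prime_gt0 hp.
(* As [p] is 3 modulo 4, [y ^+ k] squares to [y * y ^+ p.-1./2], which is [y] modulo [p]: an
   explicit square root. *)
set k := (p.+1 %/ 4)%N.
have pz : p%:Z != 0 by lia.
have xp : (`|(y ^+ k %% p)%Z| < p)%N.
  by have := modz_ge0 (y ^+ k) pz; have := ltz_mod (y ^+ k) pz; lia.
exists (Ordinal xp); rewrite /= gez0_abs ?modz_ge0// modzXm.
rewrite eqz_mod_dvd (dvdz_pcharf (pchar_Fp hp)) rmorphB /= !rmorphXn /= subr_eq0.
rewrite -exprM.
have -> : (k * 2 = (p.-1./2).+1)%N by lia.
by move/eqP: e => e; rewrite exprS e mulr1.
Qed.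

(** * Reduced triples and their sign *)

(* The triple (a, c, m) stands for the larger root of a X^2 - (a + c + m) X + c;
   [m > 0] says that the quadratic is negative at 1. *)
Definition reduced_triple (D : int) (t : int * int * int) : bool :=
  let: (a, c, m) := t in
  [&& 0 < a, 0 < c, 0 < m & (m + a - c) ^+ 2 + 4 * m * c == D].

(* The first term is the genus character modulo p of the form (m, x, - c), where
   x = m + a - c; it flips under negation of the form since p = 3 mod 4.  The other
   two record how the roots of the form are permuted modulo the primes above 2. *)
Definition triple_char (p : nat) (a c m : int) : bool :=
  euler_residue p (if (p %| m)%Z then - c else m)
  (+) ((m + a - c) %% 4 == 3)%Z (+) ((2 %| m)%Z && (2 %| c)%Z).

Lemma odd_middle_coef (D a c m : int) :
  (D %% 4 = 1)%Z -> (m + a - c) ^+ 2 + 4 * m * c = D ->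
  exists k, m + a - c = 2 * k + 1.
Proof.
set x := m + a - c => D1 eD.
have : (x %% 2 = 0 \/ x %% 2 = 1)%Z by clear; lia.
case=> xr; have xk := divz_eq x 2; rewrite xr mulrC in xk.
  exfalso; move: D1; rewrite -eD xk addr0.
  have -> : (2 * (x %/ 2)%Z) ^+ 2 + 4 * m * c = 4 * ((x %/ 2)%Z ^+ 2 + m * c) by ring.
  by rewrite modzMr.
by exists (x %/ 2)%Z.
Qed.

(** If [p] divides [m], it divides x = m + a - c, so [a] and [c] agree modulo [p]. At 2, the odd
    number x becomes 2 m - x. For odd [m] this is x modulo 4; for even [m] it is - x, but then [a]
    and [c] have opposite parity, so the last term changes as well. *)
Lemma triple_char_swap (p : nat) (D a c m : int) : prime p ->
  (p %| D)%Z -> (D %% 4 = 1)%Z -> (m + a - c) ^+ 2 + 4 * m * c = D ->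
  triple_char p c a m = triple_char p a c m.
Proof.
move=> hp pD D1 eD; rewrite /triple_char -!addbA; congr (_ (+) _).
  case: ifP => // pm; apply: eq_euler_residue => //.
  have : (p %| (m + a - c) ^+ 2)%Z.
    have -> : (m + a - c) ^+ 2 = D - m * (4 * c) by rewrite -eD; ring.
    by apply: rpredB; rewrite // dvdz_mulr.
  rewrite Euclid_dvdz_sqr// => px.
  have -> : - a - - c = m - (m + a - c) by ring.
  exact: rpredB.
have [k xk] := odd_middle_coef D1 eD.
have -> : m + c - a = 2 * m - (2 * k + 1) by rewrite -xk; ring.
rewrite xk.
have -> : a = 2 * k + 1 - m + c by rewrite -xk; ring.
clear.
have [[u ->]|[u ->]] : (exists u, m = 2 * u) \/ (exists u, m = 2 * u + 1).
  have : (m %% 2 = 0 \/ m %% 2 = 1)%Z by lia.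
  by case=> ?; [left | right]; exists (m %/ 2)%Z; lia.
- have -> : (2 %| 2 * k + 1 - 2 * u + c)%Z = ~~ (2 %| c)%Z by lia.
  have -> : (2 %| 2 * u)%Z by lia.
  rewrite /= addbN -addNb; congr (_ (+) _).
  lia.
- have -> : (2 %| 2 * u + 1)%Z = false by lia.
  by rewrite /= !addbF; lia.
Qed.

(** Only x changes, to - x; being odd, it moves between 1 and 3 modulo 4. *)
Lemma triple_char_opp (p : nat) (D a c m : int) :
  (D %% 4 = 1)%Z -> (m + a - c) ^+ 2 + 4 * m * c = D ->
  triple_char p (2 * (c - m) - a) c m = ~~ triple_char p a c m.
Proof.
move=> D1 eD; rewrite /triple_char -!addbA -addbN; congr (_ (+) _).
rewrite -addNb; congr (_ (+) _).
have [k xk] := odd_middle_coef D1 eD.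
have -> : m + (2 * (c - m) - a) - c = - (2 * k + 1) by rewrite -xk; ring.
by rewrite xk; clear; lia.
Qed.

(** Since x is kept, only the genus term can change. If [p] divides neither [m] nor [c], then 4 m c
    = - x^2 modulo [p], so exactly one of them is a residue. If [p] divides one of them, the
    argument changes sign; it cannot divide both, as p^2 does not divide [D]. *)
Lemma triple_char_exchange (p : nat) (D a c m : int) :
  prime p -> (p = 3 %[mod 4])%N -> (p %| D)%Z -> ~~ (p%:Z ^+ 2 %| D)%Z ->
  (m + a - c) ^+ 2 + 4 * m * c = D ->
  triple_char p (a + 2 * m - 2 * c) m c = ~~ triple_char p a c m.
Proof.
move=> hp hp3 pD ppD eD; rewrite /triple_char.
have -> : c + (a + 2 * m - 2 * c) - m = m + a - c by ring.
rewrite [X in _ (+) X]andbC -!addbA -addNb; congr (_ (+) _).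
set x := m + a - c in eD.
have pX (y : int) := Euclid_dvdz_sqr y hp.
have pM (y z : int) := Euclid_dvdzM y z hp.
case pm : (p %| m)%Z; case pc : (p %| c)%Z.
- have px : (p %| x)%Z.
    rewrite -pX; have -> : x ^+ 2 = D - m * (4 * c) by rewrite -eD; ring.
    by apply: rpredB; rewrite // dvdz_mulr.
  case/negP: ppD; rewrite -eD; apply: rpredD; first exact: dvdz_exp2r.
  by rewrite -mulrA dvdz_mull// expr2 dvdz_mul.
- by rewrite euler_residueN ?pc// negbK.
- by rewrite euler_residueN ?pm.
have p2 : ~~ (p %| 2)%Z.
  by rewrite dvdzE !absz_nat gtnNdvd//; clear -hp3; lia.
have px : ~~ (p %| x)%Z.
  rewrite -pX; apply/negP => px.
  have : (p %| D - x ^+ 2)%Z by apply: rpredB.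
  have -> : D - x ^+ 2 = 2 * 2 * m * c by rewrite -eD; ring.
  by rewrite !pM pm pc (negbTE p2).
(* The factor 4 is split so that the residue of 2 enters twice and its value does not matter. *)
have e : euler_residue p ((2 * m) * (2 * c)) = ~~ euler_residue p (x ^+ 2).
  rewrite -euler_residueN ?pX; [apply: eq_euler_residue | | |] => //.
  by have -> : 2 * m * (2 * c) - - x ^+ 2 = D by rewrite -eD; ring.
move: e; rewrite euler_residue_sqr// !euler_residueM ?pM ?pm ?pc ?orbF//.
by case: (euler_residue p 2); case: (euler_residue p m); case: (euler_residue p c).
Qed.

(** * Counting triples by involutions *)

Lemma eq_card_fset_invol (T : choiceType) (f : T -> T) (A B : {fset T}) :
  {in A, forall x, f x \in B /\ f (f x) = x} ->
  {in B, forall x, f x \in A /\ f (f x) = x} -> #|` A| = #|` B|.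
Proof.
have half (A1 B1 : {fset T}) :
    {in A1, forall x, f x \in B1 /\ f (f x) = x} -> (#|` A1| <= #|` B1|)%N.
  move=> fAB; have <- : #|` (f @` A1)%fset| = #|` A1|.
    apply: card_in_imfset => x y xA yA fxy.
    by rewrite -(fAB x xA).2 fxy (fAB y yA).2.
  apply: fsubset_leq_card; apply/fsubsetP => y /imfsetP[x xA ->].
  exact: (fAB x xA).1.
by move=> fAB fBA; apply/eqP; rewrite eqn_leq !half.
Qed.

Lemma card_fset_split (T : choiceType) (A : {fset T}) (P : pred T) :
  #|` A| = (#|` [fset x in A | P x]%fset| + #|` [fset x in A | ~~ P x]%fset|)%N.
Proof.
rewrite -(cardfsID [fset x in A | P x]%fset A).
have -> : (A `&` [fset x in A | P x] = [fset x in A | P x])%fset.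
  by apply/fsetP => x; rewrite !inE /= andbA andbb.
have -> : (A `\` [fset x in A | P x] = [fset x in A | ~~ P x])%fset => //.
by apply/fsetP => x; rewrite !inE /=; case: (x \in A); rewrite ?andbT ?andbF.
Qed.

Lemma finite_reduced_triple (D : int) :
  finite_set [set` reduced_triple D].
Proof.
set I := ((fun n : nat => n%:Z) @` `I_(`|D|.+1))%classic.
have fI : finite_set I by apply: finite_image; exact: finite_II.
apply: (@sub_finite_set _ _ ((I `*` I) `*` I)%classic); last first.
  by do 2 apply: finite_setX => //.
move=> [[a c] m] /= /and4P[a0 c0 m0 /eqP eD].
have mD (z : int) : 0 < z -> z <= D -> I z.
  by move=> z0 zD; exists `|z|%N => /=; lia.
(* In this form every summand is nonnegative, which bounds [a], [c] and [m] by [D]. *)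
have {}eD : (a - c) ^+ 2 + m ^+ 2 + 2 * m * a + 2 * m * c = D by rewrite -eD; ring.
have sq : 0 <= (a - c) ^+ 2 by apply: sqr_ge0.
by split; [split|] => /=; apply: mD => //; nia.
Qed.

Definition triple_swap (t : int * int * int) := let: (a, c, m) := t in (c, a, m).

Lemma triple_swapK : involutive triple_swap.
Proof. by case=> [[]]. Qed.

Lemma reduced_triple_swap (D : int) (t : int * int * int) :
  reduced_triple D (triple_swap t) = reduced_triple D t.
Proof.
case: t => [[a c] m] /=; rewrite andbCA; do 3 congr (_ && _).
by congr (_ == _); ring.
Qed.

(* In terms of x = m + a - c, so that D = x ^ 2 + 4 m c, the two branches are
   x |-> - x and the exchange of m and c; each is applied where it
   preserves positivity of a. *)
Definition triple_flip (t : int * int * int) :=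
  let: (a, c, m) := t in
  if a < 2 * (c - m) then (2 * (c - m) - a, c, m)
  else (a + 2 * m - 2 * c, m, c).

(** Positivity of [a] puts the image in the branch it came from, and each branch undoes itself. *)
Lemma triple_flipK (D : int) (t : int * int * int) :
  reduced_triple D t -> triple_flip (triple_flip t) = t.
Proof.
case: t => [[a c] m] /and4P[a0 _ _ _]; rewrite /triple_flip.
case: ltP => h; case: ltP => h'; try (exfalso; lia).
  by congr (_, _, _); ring.
by congr (_, _, _); ring.
Qed.

Lemma reduced_triple_flip (D : int) (t : int * int * int) :
  (forall y : int, y ^+ 2 != D) ->
  reduced_triple D t -> reduced_triple D (triple_flip t).
Proof.
case: t => [[a c] m] nsq /and4P[a0 c0 m0 /eqP eD]; rewrite /triple_flip.
case: ltP => h; apply/and4P; split; rewrite -?eD//; try lia.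
(* Equality would make the new first entry 0; but then x = c - m and [D] is the square of c + m. *)
have : a != 2 * (c - m).
  by apply: contra (nsq (c + m)) => /eqP ea; rewrite -eD ea; apply/eqP; ring.
lia.
Qed.

(** The number [k] counts the triples of positive sign, which the flip matches with those of
    negative sign. *)
Lemma card_reduced_triple (p : nat) (D : int) :
  prime p -> (p = 3 %[mod 4])%N -> (p %| D)%Z -> ~~ (p%:Z ^+ 2 %| D)%Z ->
  (D %% 4 = 1)%Z ->
  exists k : nat, #|` fset_set [set` reduced_triple D]| = (2 * k)%N /\
    odd k = odd #|` fset_set [set t : int * int * int |
      [/\ reduced_triple D t, t.1.1 = t.1.2
       & triple_char p t.1.1 t.1.2 t.2]]|.
Proof.
move=> hp hp3 pD ppD D1.
have nsq (y : int) : y ^+ 2 != D.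
  apply: contra ppD => /eqP yD; rewrite -yD; apply: dvdz_exp2r.
  by rewrite -(Euclid_dvdz_sqr y hp) yD.
set T := fset_set _.
pose chi (t : int * int * int) := triple_char p t.1.1 t.1.2 t.2.
have TE t : (t \in T) = reduced_triple D t.
  by rewrite in_fset_set ?mem_setE//; exact: finite_reduced_triple.
have chi_swap t : t \in T -> chi (triple_swap t) = chi t.
  case: t => [[a c] m]; rewrite TE => /and4P[_ _ _ /eqP eD].
  exact: (triple_char_swap hp pD D1 eD).
have chi_flip t : t \in T -> chi (triple_flip t) = ~~ chi t.
  case: t => [[a c] m]; rewrite TE => /and4P[_ _ _ /eqP eD].
  rewrite /chi /triple_flip; case: ifP => _ /=.
    exact: (triple_char_opp _ D1 eD).
  exact: (triple_char_exchange hp hp3 pD ppD eD).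
pose Tp := [fset t in T | chi t]%fset; pose Tn := [fset t in T | ~~ chi t]%fset.
have TpE : #|` Tp| = #|` Tn|.
  apply: (@eq_card_fset_invol _ triple_flip) => t; rewrite !inE /= => /andP[tT ct].
    rewrite chi_flip// ct andbT TE (triple_flipK (D := D)) -?TE//.
    by split=> //; rewrite TE reduced_triple_flip -?TE.
  rewrite chi_flip// ct andbT TE (triple_flipK (D := D)) -?TE//.
  by split=> //; rewrite TE reduced_triple_flip -?TE.
exists #|` Tp|; split.
  by rewrite (card_fset_split T chi) -/Tp -/Tn -TpE; lia.
rewrite (card_fset_split Tp (fun t => t.1.1 == t.1.2)) oddD.
set N := [fset t in Tp | ~~ _]%fset.
(* Off the diagonal, the swap exchanges a < c with a > c, so these triples contribute an even
   number. *)
rewrite (card_fset_split N (fun t => t.1.1 < t.1.2)).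
have <- : #|` [fset t in N | t.1.1 < t.1.2]%fset| =
          #|` [fset t in N | ~~ (t.1.1 < t.1.2)]%fset|.
  apply: (@eq_card_fset_invol _ triple_swap) => -[[a c] m]; rewrite triple_swapK.
    rewrite !inE /= -!andbA => /and4P[tT ct ac lt]; split=> //.
    rewrite (chi_swap (a, c, m))// ct TE (reduced_triple_swap _ (a, c, m)) -TE tT.
    by rewrite /= eq_sym ac -leNgt ltW.
  rewrite !inE /= -!andbA => /and4P[tT ct ac lt]; split=> //.
  rewrite (chi_swap (a, c, m))// ct TE (reduced_triple_swap _ (a, c, m)) -TE tT.
  by rewrite /= eq_sym ac lt_def ac leNgt.
rewrite addnn odd_double addbF; set U := fset_set _.
suff -> : [fset t in Tp | t.1.1 == t.1.2]%fset = U by [].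
apply/fsetP => t; rewrite in_fset_set; last first.
  apply: sub_finite_set (finite_reduced_triple D) => u; by case.
apply/idP/idP => [tA|/set_mem[tT te ct]].
  apply/mem_set; move: tA.
  rewrite !inE /= => /andP[/andP[tT ct] /eqP te].
  by split; rewrite // -TE.
by rewrite !inE /= TE tT te eqxx andbT.
Qed.

(** When a = c, x = m and the discriminant factors as m (m + 4 c); here [m] is the strictly smaller
    factor of p q. *)
Lemma diagonal_triple_eq (p q : nat) (c m : int) :
  prime p -> prime q -> (p < q)%N -> 0 < c -> 0 < m ->
  m * (m + 4 * c) = (p * q)%N -> m = 1 \/ m = p.
Proof.
move=> hp hq pq c0 m0; have [n nm] : exists n : nat, m = n by exists `|m|%N; lia.
have [d dc] : exists d : nat, c = d by exists `|c|%N; lia.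
rewrite {}nm {}dc in c0 m0 *; move=> e.
have {}e : (n * (n + 4 * d) = p * q)%N by apply/eqP; rewrite -eqz_nat -e; lia.
have q0 := prime_gt0 hq; have p0 := prime_gt0 hp.
have : (p %| n * (n + 4 * d))%N by rewrite e dvdn_mulr.
rewrite Euclid_dvdM// => /orP[] /dvdnP[u un].
  have {}e : (u * (n + 4 * d) = q)%N.
    by apply/eqP; rewrite -(eqn_pmul2l p0) -e un; apply/eqP; ring.
  have /(primeP hq).2 : (u %| q)%N by rewrite -e dvdn_mulr.
  by case/orP => /eqP u1; [right; rewrite un u1 mul1n | nia].
have {}e : (n * u = q)%N.
  by apply/eqP; rewrite -(eqn_pmul2l p0) -e un; apply/eqP; ring.
have /(primeP hq).2 : (n %| q)%N by rewrite -e dvdn_mulr.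
by case/orP => /eqP n1; [left; rewrite n1 | nia].
Qed.

(** * Quadratic irrationals *)

(** Otherwise [D] would be the square of x / y, hence a perfect square, against squarefreeness and
    [1 < D]. *)
Lemma sqrt_rat_free (R : realType) (D : nat) (x y : int) :
  (forall d : nat, (d ^ 2 %| D)%N -> d = 1%N) -> (1 < D)%N ->
  x%:~R + y%:~R * Num.sqrt (D%:R : R) = 0 -> y = 0.
Proof.
move=> sqf D1 e; apply/eqP/contraT => y0.
have {}e : x ^+ 2 = D%:Z * y ^+ 2.
  apply: (@intr_inj R); rewrite [RHS]rmorphM /= !rmorphXn /=.
  have -> : (x%:~R : R) = - (y%:~R * Num.sqrt (D%:R : R)).
    by apply/eqP; rewrite -addr_eq0 e.
  by rewrite sqrrN exprMn sqr_sqrtr ?ler0n// mulrC.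
have {}e : (`|x| ^ 2 = D * `|y| ^ 2)%N by rewrite -!abszX e abszM.
have : (`|y| ^ 2 %| `|x| ^ 2)%N by rewrite e dvdn_mull.
rewrite dvdn_pexp2r// => /dvdnP[z xz].
have zD : (z ^ 2 = D)%N.
  apply/eqP; rewrite -(@eqn_pmul2r (`|y| ^ 2)); first by rewrite -e xz expnMn.
  by rewrite expn_gt0 absz_gt0 y0.
by have := sqf z; rewrite zD dvdnn => /(_ isT) z1; rewrite -zD z1 in D1.
Qed.

Definition int_quadratic (a b c : int) : {poly int} := Poly [:: c; b; a].

Lemma size_int_quadratic (a b c : int) : a != 0 -> size (int_quadratic a b c) = 3%N.
Proof. by move=> a0; rewrite (PolyK (c := 0)). Qed.

Lemma root_int_quadratic (R : realType) (a b c : int) (w : R) :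
  root (map_poly intr (int_quadratic a b c)) w =
  (a%:~R * w ^+ 2 + b%:~R * w + c%:~R == 0).
Proof.
rewrite /root /int_quadratic map_Poly_id0 ?rmorph0// horner_Poly /=.
by congr (_ == _); ring.
Qed.

Lemma map_poly_ratr_intr (R : realType) (P : {poly int}) :
  map_poly (ratr : rat -> R) (map_poly intr P) = map_poly intr P.
Proof. by rewrite -map_poly_comp; apply: eq_map_poly => x /=; rewrite ratr_int. Qed.

(** The remainder of [P] by [Q] has degree at most 1 and rational coefficients; if it vanishes at an
    irrational number, it is zero. *)
Lemma root_irrational_quadratic (R : realType) (w : R) (Q P : {poly rat}) :
  irrational w -> size Q = 3%N -> root (map_poly ratr Q) w ->
  root (map_poly ratr P) w = (Q %| P).
Proof.
move=> irr sQ /rootP Qw; rewrite {1}(divp_eq P Q) rmorphD rmorphM /= /root.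
rewrite hornerD hornerM Qw mulr0 add0r.
have Q0 : Q != 0 by rewrite -size_poly_eq0 sQ.
apply/idP/idP => [|/modp_eq0 ->]; last by rewrite rmorph0 horner0.
have : (size (P %% Q)%R <= 2)%N by have := ltn_modpN0 P Q0; rewrite sQ ltnS.
rewrite /dvdp; set S : {poly rat} := P %% Q => sS.
have -> : S = S`_1 *: 'X + (S`_0)%:P.
  apply/polyP => i; rewrite coefD coefZ coefX coefC.
  case: i => [|[|i]]; rewrite ?mulr0 ?mulr1 ?add0r ?addr0//=.
  by rewrite nth_default// (leq_trans sS).
rewrite rmorphD /= map_polyZ map_polyX map_polyC /= !hornerE => /eqP e.
have S1 : S`_1 = 0.
  apply/eqP/contraT => S1; exfalso; apply: irr; exists (- S`_0 / S`_1) => //.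
  have S1' : ratr S`_1 != 0 :> R by rewrite fmorph_eq0.
  rewrite fmorph_div rmorphN /=; apply: (mulfI S1').
  rewrite mulrC mulfVK//; apply/eqP; rewrite eq_sym -subr_eq0 opprK; exact/eqP.
move: e; rewrite S1 rmorph0 mul0r add0r => /eqP; rewrite fmorph_eq0 => /eqP ->.
by rewrite scale0r polyC0 addr0.
Qed.

(** * The number of triples modulo 4 *)

Lemma card_reduced_triple_mod4 (p q : nat) :
  prime p -> prime q -> (p < q)%N -> (p = 3 %[mod 4])%N -> (q = 3 %[mod 4])%N ->
  (#|` fset_set [set` reduced_triple (p * q)%N]|%:Z
    = 1 - legendre q%:Z p %[mod 4])%Z.
Proof.
move=> hp hq pq hp3 hq3.
have pqN : ~~ (p %| q)%N by rewrite dvdn_prime2// ltn_eqF.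
have pqZ : ~~ (p %| q%:Z)%Z by rewrite dvdzE.
have [||| k [-> ok]] := @card_reduced_triple p (p * q)%N hp hp3.
- by rewrite dvdzE /= dvdn_mulr.
- by rewrite dvdzE abszX /= expnS expn1 dvdn_pmul2l// prime_gt0.
- have -> : p = (4 * (p %/ 4) + 3)%N by lia.
  have -> : q = (4 * (q %/ 4) + 3)%N by lia.
  lia.
rewrite legendre_euler//.
(* Both sides are even, so the parity of [k] decides: [2 * k] must be 0 modulo 4 for a residue and 2
   otherwise. *)
suff okE : odd k = ~~ euler_residue p q.
  by case: (euler_residue p q) okE => /= ?; lia.
rewrite {}ok.
have q0 := prime_gt0 hq; have p0 := prime_gt0 hp.
have pp : (1 < p)%N := prime_gt1 hp.
have pq1 : ((p * q) %% 4 = 1)%N by rewrite -modnMm hp3 hq3.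
(* These are the values of c with m (m + 4 c) = p q for m = 1 and m = p; the first division drops
   the remainder 1. *)
set c1 : int := ((p * q) %/ 4)%N; set c2 : int := ((q - p) %/ 4)%N.
have Ec1 : 4 * c1 + 1 = (p * q)%N by rewrite /c1; clear -pq1; lia.
have Ec2 : 4 * c2 + p%:Z = q by rewrite /c2; clear -hp3 hq3 pq; lia.
have c1_gt0 : 0 < c1 by rewrite /c1; clear -pq pp pq1; nia.
have c2_gt0 : 0 < c2 by clear -Ec2 pq hp3 hq3; lia.
have p1 : (p %| 1)%Z = false by rewrite dvdz1 absz_nat; clear -pp; lia.
have chi1 : triple_char p c1 c1 1.
  rewrite /triple_char p1 addrK /euler_residue rmorph1 expr1n eqxx.
  by clear; lia.
(* Here x = p is 3 modulo 4, and this negation cancels the one from - c2; moreover q = 4 c2 modulo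
   [p]. *)
have chi2 : triple_char p c2 c2 p = euler_residue p q.
  rewrite /triple_char dvdzz addrK.
  have -> : (p %% 4 == 3)%Z by clear -hp3; lia.
  have -> : (2 %| p%:Z)%Z = false by clear -hp3; lia.
  have pM (y z : int) := Euclid_dvdzM y z hp.
  have pc2 : ~~ (p %| c2)%Z.
    apply/negP => pc; case/negP: pqZ.
    have : (p %| (4 * c2 + p%:Z)%R)%Z by rewrite rpredD ?dvdzz// pM pc orbT.
    by rewrite Ec2.
  have p2 : ~~ (p %| 2)%Z.
    by rewrite dvdzE !absz_nat gtnNdvd//; clear -hp3 pp; lia.
  rewrite /= addbF euler_residueN// addbT negbK.
  rewrite -(@eq_euler_residue p (2 * 2 * c2) q%:Z)//; last first.
    have -> : 2 * 2 * c2 - q%:Z = - p%:Z by rewrite -Ec2; ring.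
    by rewrite rpredN dvdzz.
  rewrite !euler_residueM ?pM ?negb_or ?p2// eqxx.
  by case: euler_residue.
set U := fset_set _.
have UE t : (t \in U) = (t == (c1, c1, 1)) || (euler_residue p q && (t == (c2, c2, p%:Z))).
  rewrite in_fset_set; last first.
    by apply: sub_finite_set (finite_reduced_triple (p * q)%N) => u; case.
  apply/idP/idP => [/set_mem|].
    case: t => [[a c] m] [/= /and4P[a0 c0 m0 /eqP eD] ac ct].
    rewrite {a}ac in a0 eD ct *.
    have eD' : m * (m + 4 * c) = (p * q)%N by rewrite -eD; ring.
    have [m1|m1] := diagonal_triple_eq hp hq pq c0 m0 eD'.
      have cc : c = c1 by rewrite m1 in eD'; clear -eD' Ec1; lia.
      by rewrite cc m1 eqxx.
    have cc : c = c2.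
      apply: (@mulfI _ 4) => //; apply: (@addrI _ p%:Z).
      apply: (@mulfI _ p%:Z); first by clear -p0; lia.
      by rewrite -{1 2}m1 eD' addrC Ec2.
    by rewrite cc m1 in ct *; rewrite eqxx -chi2 ct orbT.
  case/orP => [/eqP ->|/andP[res /eqP ->]]; apply/mem_set; split=> //=.
  - by rewrite c1_gt0 addrK -Ec1 /=; apply/eqP; ring.
  - by rewrite c2_gt0 addrK /= ltz_nat p0 /= PoszM -Ec2; apply/eqP; ring.
  - by rewrite chi2.
case: (euler_residue p q) UE => /= UE.
  have -> : U = [fset (c1, c1, 1%Z); (c2, c2, p%:Z)]%fset.
    by apply/fsetP => t; rewrite UE !inE.
  rewrite cardfs2; suff -> : (c1, c1, 1%Z) != (c2, c2, p%:Z) by [].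
  by apply/eqP => -[_ _ ]; clear -pp; lia.
have -> : U = [fset (c1, c1, 1%Z)]%fset by apply/fsetP => t; rewrite UE !inE orbF.
by rewrite cardfs1.
Qed.

(** * The correspondence between m-reduced numbers and triples *)

(** A rational value would relate 1 and the square root of [D] linearly. The two signs of [s] serve
    a number and its conjugate. *)
Lemma surd_irrational (R : realType) (D : nat) (a b : int) (s : R) :
  (forall d : nat, (d ^ 2 %| D)%N -> d = 1%N) -> (1 < D)%N -> a != 0 ->
  s = Num.sqrt D%:R \/ s = - Num.sqrt D%:R ->
  irrational ((b%:~R + s) / a%:~R).
Proof.
move=> sqf D1 a0 es /rationalP[n [d e]].
have a0' : (a%:~R : R) != 0 by rewrite intr_eq0.
(* A zero denominator is possible here and makes the quotient 0, so it needs a relation of its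
   own. *)
have [d0|d0] := eqVneq d 0%N.
  move: e; rewrite d0 invr0 mulr0 => /eqP; rewrite mulf_eq0 invr_eq0 (negbTE a0') orbF.
  move=> /eqP e; case: es => es; rewrite es in e.
    by have := @sqrt_rat_free R D b 1 sqf D1; rewrite mul1r => /(_ e).
  by have := @sqrt_rat_free R D b (- 1) sqf D1; rewrite mulN1r => /(_ e).
have d0' : (d%:R : R) != 0 by rewrite pnatr_eq0.
have {}e : (b * d%:Z - n * a)%:~R + (d%:Z)%:~R * s = 0 :> R.
  rewrite rmorphB !rmorphM /= -[(d%:Z)%:~R]/(d%:R).
  have -> : (n%:~R : R) = (b%:~R + s) / a%:~R * d%:R by rewrite e mulfVK.
  by field.
case: es => es; rewrite es in e.
  by move/(sqrt_rat_free sqf D1): e => [] /eqP; rewrite (negbTE d0).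
rewrite mulrN -mulNr -rmorphN in e.
by move/(sqrt_rat_free sqf D1): e; lia.
Qed.

(** The assumption on [s] says that its square is the discriminant (A + C + M)^2 - 4 A C. *)
Lemma quadratic_root_surd (F : realFieldType) (A C M s : F) :
  A != 0 -> s ^+ 2 = (M + A - C) ^+ 2 + 4 * M * C ->
  A * ((A + C + M + s) / (2 * A)) ^+ 2
    + - (A + C + M) * ((A + C + M + s) / (2 * A)) + C = 0.
Proof.
move=> A0 e.
have -> : A * ((A + C + M + s) / (2 * A)) ^+ 2
    + - (A + C + M) * ((A + C + M + s) / (2 * A)) + C =
    (s ^+ 2 - ((M + A - C) ^+ 2 + 4 * M * C)) / (4 * A) by field.
by rewrite e subrr mul0r.
Qed.

(** For the roots w, w' = (A + C + M ± s) / (2 A), the bounds mean w' < 1, w > 1 and w' > 0, in this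
    order. The squares compared differ by 4 M A and 4 A C. *)
Lemma sqrt_disc_bounds (F : realFieldType) (A C M s : F) :
  0 < A -> 0 < C -> 0 < M -> 0 < s ->
  s ^+ 2 = (M + A - C) ^+ 2 + 4 * M * C ->
  - s < A - C - M < s /\ s < A + C + M.
Proof.
move=> A0 C0 M0 s0 e; split.
  rewrite -ltr_norml -(@ltr_pXn2r _ 2)// ?nnegrE ?normr_ge0 ?(ltW s0)//
    real_normK ?num_real// e.
  rewrite -subr_gt0.
  have -> : (M + A - C) ^+ 2 + 4 * M * C - (A - C - M) ^+ 2 = 4 * M * A by ring.
  by rewrite !mulr_gt0.
rewrite -(@ltr_pXn2r _ 2)// ?nnegrE ?addr_ge0 ?(ltW A0) ?(ltW C0) ?(ltW M0) ?(ltW s0)//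
  e -subr_gt0.
have -> : (A + C + M) ^+ 2 - ((M + A - C) ^+ 2 + 4 * M * C) = 4 * A * C by ring.
by rewrite !mulr_gt0.
Qed.

Definition triple_root (R : realType) (D : nat) (t : int * int * int) : R :=
  let: (a, c, m) := t in
  ((a + c + m)%:~R + Num.sqrt D%:R) / (2 * a)%:~R.

Lemma m_reduced_triple_root (R : realType) (D : nat) (t : int * int * int) :
  (forall d : nat, (d ^ 2 %| D)%N -> d = 1%N) -> (1 < D)%N ->
  reduced_triple D t ->
  m_reduced (triple_root R D t) /\ has_disc (triple_root R D t) D.
Proof.
case: t => [[a c] m] sqf D1 /and4P[a0 c0 m0 /eqP eD].
set w := triple_root R D _.
pose s : R := Num.sqrt D%:R.
pose w' : R := ((a + c + m)%:~R - s) / (2 * a)%:~R.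
have a2 : 2 * a != 0 by clear -a0; lia.
have irw : irrational w by apply: (surd_irrational sqf D1 a2); left.
have irw' : irrational w' by apply: (surd_irrational sqf D1 a2); right.
have A0 : 0 < a%:~R :> R by rewrite ltr0z.
have C0 : 0 < c%:~R :> R by rewrite ltr0z.
have M0 : 0 < m%:~R :> R by rewrite ltr0z.
have s2 : s ^+ 2 = (m%:~R + a%:~R - c%:~R) ^+ 2 + 4 * m%:~R * c%:~R.
  rewrite sqr_sqrtr ?ler0n//.
  have -> : D%:R = (D%:Z)%:~R :> R by [].
  by rewrite -eD rmorphD rmorphXn rmorphB rmorphD !rmorphM.
have s0 : 0 < s by rewrite sqrtr_gt0 ltr0n; clear -D1; lia.
have wE : w = (a%:~R + c%:~R + m%:~R + s) / (2 * a%:~R).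
  by rewrite /w /= !rmorphD rmorphM.
have w'E : w' = (a%:~R + c%:~R + m%:~R - s) / (2 * a%:~R).
  by rewrite /w' /= !rmorphD rmorphM.
have Aneq : a%:~R != 0 :> R by rewrite gt_eqF.
pose B := - (a + c + m).
have rw : a%:~R * w ^+ 2 + B%:~R * w + c%:~R = 0.
  by rewrite wE /B rmorphN !rmorphD /=; exact: quadratic_root_surd.
have rw' : a%:~R * w' ^+ 2 + B%:~R * w' + c%:~R = 0.
  rewrite w'E /B rmorphN !rmorphD /=; apply: quadratic_root_surd => //.
  by rewrite sqrrN.
have an0 : a != 0 by clear -a0; lia.
pose Q := int_quadratic a B c.
have sQ : size Q = 3%N := size_int_quadratic B c an0.
have sQr : size (map_poly (intr : int -> rat) Q) = 3%N.
  by rewrite size_map_poly_id0 ?sQ// intr_eq0 lead_coef_eq0 -size_poly_eq0 sQ.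
split; last first.
  exists a, B, c; split=> //; last by rewrite /B -eD; ring.
  (* The square of the gcd divides the discriminant, so squarefreeness makes the polynomial
     primitive. *)
  have gdvd x : x = a \/ x = B \/ x = c -> (gcdz a (gcdz B c) %| x)%Z.
    move=> [->|[->|->]]; first exact: dvdz_gcdl.
      by apply: dvdz_trans (dvdz_gcdr _ _) (dvdz_gcdl _ _).
    by apply: dvdz_trans (dvdz_gcdr _ _) (dvdz_gcdr _ _).
  have : (gcdz a (gcdz B c) ^+ 2 %| D%:Z)%Z.
    have -> : D%:Z = B ^+ 2 - 4 * (a * c) by rewrite /B -eD; ring.
    apply: rpredB; first by apply: dvdz_exp2r; apply: gdvd; auto.
    by rewrite dvdz_mull// expr2 dvdz_mul// gdvd; auto.
  rewrite dvdzE abszX absz_nat => /sqf g1.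
  by rewrite -[LHS]gez0_abs ?g1.
split.
- split => //; exists Q; split=> //.
  by rewrite root_int_quadratic rw.
- rewrite wE ltr_pdivlMr ?mulr_gt0// mul1r.
  by have [/andP[lo hi] _] := sqrt_disc_bounds A0 C0 M0 s0 s2; lra.
exists w'.
  split.
    rewrite wE w'E; apply/eqP => /(congr1 (fun x => x * (2 * a%:~R))).
    rewrite !mulfVK ?mulf_neq0//; clear -s0; lra.
  (* Both [w] and [w'] are irrational roots of [Q], so for each of them being a root of [P] means
     that [Q] divides [P]. *)
  move=> P.
  rewrite (root_irrational_quadratic P irw sQr); last first.
    by rewrite map_poly_ratr_intr root_int_quadratic rw.
  rewrite (root_irrational_quadratic P irw' sQr)//.
  by rewrite map_poly_ratr_intr root_int_quadratic rw'.
rewrite w'E ltr_pdivlMr ?mulr_gt0// ltr_pdivrMr ?mulr_gt0// mul0r mul1r.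
have [/andP[lo hi] sB] := sqrt_disc_bounds A0 C0 M0 s0 s2.
by apply/andP; split; lra.
Qed.

(** Vieta's formulas give c = a w w' > 0 and m = a (w - 1) (1 - w') > 0; the square root of [D] is a
    (w - w'), so [w] is the larger root. *)
Lemma reduced_triple_of_m_reduced (R : realType) (D : nat) (w : R) :
  m_reduced w -> has_disc w D ->
  exists2 t, reduced_triple D t & triple_root R D t = w.
Proof.
move=> [_ w1 [w' [w'w conj] /andP[w'0 w'1]]] [a [b [c [a0 _ rw eD]]]].
have rw' : a%:~R * w' ^+ 2 + b%:~R * w' + c%:~R = 0.
  apply/eqP; rewrite -root_int_quadratic -map_poly_ratr_intr -conj.
  by rewrite map_poly_ratr_intr root_int_quadratic rw.
have A0 : 0 < a%:~R :> R by rewrite ltr0z.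
have ww' : w - w' != 0 by rewrite subr_eq0 eq_sym.
have bE : b%:~R = - (a%:~R * (w + w')).
  apply/eqP; rewrite -addr_eq0 -(mulrI_eq0 _ (mulfI ww')); apply/eqP.
  rewrite -[RHS](subrr 0) -{1}rw -rw'; ring.
have cE : c%:~R = a%:~R * (w * w').
  by move: rw; rewrite bE => e; lra.
have c0 : 0 < c by rewrite -(ltr0z R) cE; apply: mulr_gt0 => //; nra.
have m0 : 0 < - (a + b + c).
  rewrite -(ltr0z R) rmorphN !rmorphD /= bE cE.
  have -> : - (a%:~R + - (a%:~R * (w + w')) + a%:~R * (w * w')) =
            a%:~R * ((w - 1) * (1 - w')) by ring.
  by rewrite !mulr_gt0 ?subr_gt0.
exists (a, c, - (a + b + c)).
  by rewrite /reduced_triple a0 c0 m0 eD; apply/eqP; ring.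
have sE : Num.sqrt D%:R = a%:~R * (w - w').
  have -> : D%:R = (a%:~R * (w - w')) ^+ 2.
    have -> : D%:R = (D%:Z)%:~R :> R by [].
    rewrite eD rmorphB rmorphXn !rmorphM /= bE cE; ring.
  by rewrite sqrtr_sqr ger0_norm// mulr_ge0 ?ltW// subr_gt0; lra.
rewrite /triple_root sE rmorphD rmorphN !rmorphD rmorphM /= bE cE.
by field; rewrite gt_eqF.
Qed.

Lemma triple_root_inj (R : realType) (D : nat) :
  (forall d : nat, (d ^ 2 %| D)%N -> d = 1%N) -> (1 < D)%N ->
  {in [set` reduced_triple D]%classic &, injective (triple_root R D)}.
Proof.
move=> sqf D1 [[a c] m] [[a' c'] m']; rewrite !inE /=.
move=> /and4P[a0 c0 m0 /eqP eD] /and4P[a0' c0' m0' /eqP eD'] e.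
have ea : a = a'.
  apply/eqP; rewrite eq_sym -subr_eq0; apply/eqP.
  (* Clearing denominators leaves a' - a as the coefficient of the square root of [D]. *)
  apply: (@sqrt_rat_free R D ((a + c + m) * a' - (a' + c' + m') * a)) => //.
  rewrite !rmorphB !rmorphM /=; move: e => /eqP.
  have A2 : (2 * a)%:~R != 0 :> R by rewrite intr_eq0; lia.
  have A2' : (2 * a')%:~R != 0 :> R by rewrite intr_eq0; lia.
  rewrite (eqr_div _ _ A2 A2') !rmorphM /= => /eqP e.
  lra.
rewrite -{a' a0'}ea in eD' e *.
have eB : a + c + m = a + c' + m'.
  have A2 : (2 * a)%:~R^-1 != 0 :> R by rewrite invr_eq0 intr_eq0; lia.
  by move: e => /(mulIf A2) /addIr /intr_inj.
have ec : c = c'.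
  have : 4 * a * c = 4 * a * c'.
    have -> : 4 * a * c = (a + c + m) ^+ 2 - D%:Z by rewrite -eD; ring.
    by rewrite eB -eD'; ring.
  by apply: mulfI; lia.
by congr (_, _, _) => //; lia.
Qed.

Lemma kappa_plusE (R : realType) (D : nat) :
  (forall d : nat, (d ^ 2 %| D)%N -> d = 1%N) -> (1 < D)%N ->
  kappa_plus R D = #|` fset_set [set` reduced_triple D]|.
Proof.
move=> sqf D1; rewrite /kappa_plus.
have -> : [set w : R | m_reduced w /\ has_disc w D]%classic =
          (triple_root R D @` [set` reduced_triple D])%classic.
  apply/seteqP; split=> [w /= [mw dw]|w [t rt <-]].
    by have [t rt tw] := reduced_triple_of_m_reduced mw dw; exists t.
  exact: m_reduced_triple_root.
have fT := finite_reduced_triple D.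
rewrite fset_set_image//; apply: card_in_imfset => t u tT uT.
by apply: triple_root_inj => //; rewrite -in_fset_set.
Qed.

(** A prime factor of [d] is [p] or [q], and its square divides p q only if p = q. *)
Lemma sqrfree_mul_primes (p q d : nat) :
  prime p -> prime q -> (p < q)%N -> (d ^ 2 %| p * q)%N -> d = 1%N.
Proof.
move=> hp hq pq dpq; apply/eqP/contraT => d1.
have pq0 : (0 < p * q)%N by rewrite muln_gt0 !prime_gt0.
have d_gt1 : (1 < d)%N.
  by case: d dpq d1 => [|[|d]] //; rewrite exp0n// dvd0n eqn0Ngt pq0.
have [r hr rd] := pdivP d_gt1.
have : (r * r %| p * q)%N by rewrite mulnn (dvdn_trans (dvdn_exp2r 2 rd)).
have : (r %| p * q)%N by rewrite (dvdn_trans rd)// (dvdn_trans _ dpq)// dvdn_exp.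
rewrite Euclid_dvdM// (dvdn_prime2 hr hp) (dvdn_prime2 hr hq) => /orP[] /eqP ->.
  by rewrite dvdn_pmul2l ?prime_gt0// dvdn_prime2// ltn_eqF.
by rewrite dvdn_pmul2r ?prime_gt0// dvdn_prime2// gtn_eqF.
Qed.

Theorem theorem3p2 (R : realType) (p q : nat)
    (hp : prime p) (hq : prime q) (hpq : (p < q)%N)
    (hp3 : (p = 3 %[mod 4])%N) (hq3 : (q = 3 %[mod 4])%N) :
  ((kappa_plus R (p * q))%:Z = 1 - legendre q%:Z p %[mod 4])%Z.
Proof.
have sqf d := @sqrfree_mul_primes p q d hp hq hpq.
have D1 : (1 < p * q)%N.
  by rewrite (leq_trans (prime_gt1 hp))// leq_pmulr// prime_gt0.
by rewrite (kappa_plusE R sqf D1); exact: card_reduced_triple_mod4.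
Qed.
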